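(* Let $S\subset\mathbb{R}^2$ be the three-chain configuration of $n$ points described in the context. For every integer $k$ with $\lfloor n/3\rfloor\leq k\leq\lfloor 5n/12\rfloor-1$, $$E_k(S)=3\binom{k+2}{2}+3\binom{k-\frac{n}{3}+2}{2},$$ which matches, for $n$ divisible by $3$, the known lower bound $3\binom{k+2}{2}+\sum_{j=\lfloor n/3\rfloor}^{k}(3j-n+3)$ on the number of $(\leq k)$-edges of a planar set of $n$ points.
   Context: A $j$-edge of a finite set $S\subset\mathbb{R}^2$ is an oriented segment $\overrightarrow{pq}$ with $p,q\in S$ distinct such that exactly $j$ points of $S$ lie in the open half-plane to the right of its supporting line, oriented from $p$ to $q$. The number of $j$-edges is denoted $e_j(S)$, and $E_k(S)=\sum_{j=0}^{k}e_j(S)$ is the number of $(\leq k)$-edges of $S$. It was previously known that every set $S$ of $n$ points in the plane satisfies $E_k(S)\geq 3\binom{k+2}{2}+\sum_{j=\lfloor n/3\rfloor}^{k}(3j-n+3)$. The configuration $S$ has $n$ points ($n$ divisible by $12$, so that the sizes below are integers) and is composed of three rotationally symmetric chains, each one associated to a convex hull vertex of $S$, with the following properties (left and right are considered with respect to the corresponding convex hull vertex). (i) The first part of each chain is slightly convex to the right and contains $\frac{3n}{12}$ points, with a hole between the first $\frac{2n}{12}$ points (called subchain $A$) and the remaining $\frac{n}{12}$ points (called subchain $B$). (ii) Each chain is completed with a subchain $C$, composed of another $\frac{n}{12}$ points, slightly convex to the left. (iii) All the lines spanned by two points in $A\cup B$, oriented from the outermost to the innermost endpoint, leave to the right the next chain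 in counterclockwise order, and to the left both the points in $C$ and those in the remaining chain. (iv) All the lines spanned by two points in $C$ separate subchains $A$ and $B$; furthermore, when oriented from the outermost to the innermost endpoint, they leave to the right the two remaining subchains of type $C$. (v) The triangle defined by the innermost points of the chains of type $B$ contains all the chains of type $C$.
   Formalization: Property (iv) is extended: lines through points of two different subchains C must also separate A and B of the appropriate one of the two chains. Without this the formula fails (n=12 can give E_4=51, not 48). In (v), containment is in the open triangle. *)

(* Defs.v *)
(* MathComp world, with the real numbers of MathComp-Analysis. *)
From mathcomp Require Import all_boot all_order all_algebra finmap reals.

Set Implicit Arguments.
Unset Strict Implicit.
Unset Printing Implicit Defensive.

Import Order.TTheory GRing.Theory Num.Theory.
Local Open Scope fset_scope.
Local Open Scope ring_scope.

Notation point R := (R * R)%type.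

Section Plane.
Variable R : realType.
Implicit Types (S : {fset point R}) (o p q r u v w : point R).

(* Twice the signed area of the triangle p q r. *)
Definition orient p q r : R :=
  (q.1 - p.1) * (r.2 - p.2) - (q.2 - p.2) * (r.1 - p.1).

Definition left_of p q r : bool := 0 < orient p q r.
Definition right_of p q r : bool := orient p q r < 0.

Definition j_edge S (j : nat) (e : point R * point R) : bool :=
  [&& e.1 \in S, e.2 \in S, e.1 != e.2
    & #|` [fset r in S | right_of e.1 e.2 r] | == j].

Definition num_j_edges S (j : nat) : nat :=
  #|` [fset e in S `*` S | j_edge S j e] |.

Definition num_le_edges S (k : nat) : nat :=
  (\sum_(j < k.+1) num_j_edges S j)%N.

Definition in_convex_hull S p : Prop :=
  exists c : point R -> R,
    [/\ forall q, 0 <= c q,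
        \sum_(q <- enum_fset S) c q = 1
      & p = (\sum_(q <- enum_fset S) c q * q.1,
             \sum_(q <- enum_fset S) c q * q.2)].

Definition hull_vertex S p : Prop :=
  p \in S /\ ~ in_convex_hull (S `\ p) p.

(* Interior of the triangle u v w when u, v, w are not collinear. *)
Definition in_triangle u v w p : Prop :=
  exists a b c : R,
    [/\ 0 < a, 0 < b, 0 < c, a + b + c = 1
      & p = (a * u.1 + b * v.1 + c * w.1, a * u.2 + b * v.2 + c * w.2)].

(* Rotation about o by the angle 2 pi / 3, counterclockwise. *)
Definition rot3 o p : point R :=
  let dx := p.1 - o.1 in
  let dy := p.2 - o.2 in
  let h := Num.sqrt 3%:R / 2%:R in
  (o.1 + (- (dx / 2%:R) - h * dy), o.2 + (h * dx - dy / 2%:R)).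

(* The sets X and Y lie in opposite open sides of the line p q. *)
Definition separates p q (X Y : point R -> Prop) : Prop :=
  ((forall r, X r -> left_of p q r) /\ (forall r, Y r -> right_of p q r)) \/
  ((forall r, X r -> right_of p q r) /\ (forall r, Y r -> left_of p q r)).

End Plane.

(* Positions in a chain are numbered from the outermost point (0) to the
   innermost one (4m - 1), where n = 12 m: the subchain A occupies [0, 2m),
   B occupies [2m, 3m) and C occupies [3m, 4m).  Both orders "from the outermost
   to the innermost" are read as increasing positions. *)
Definition posA (n s : nat) : bool := (s < 2 * (n %/ 12))%N.
Definition posB (n s : nat) : bool :=
  (2 * (n %/ 12) <= s)%N && (s < 3 * (n %/ 12))%N.
Definition posAB (n s : nat) : bool := posA n s || posB n s.
Definition posC (n s : nat) : bool :=
  (3 * (n %/ 12) <= s)%N && (s < 4 * (n %/ 12))%N.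
Definition in_chain (n s : nat) : bool := (s < 4 * (n %/ 12))%N.

Section ThreeChains.
Variable R : realType.

(* The s-th point of the i-th chain.  Chain i + 1 is the next chain after chain i
   in counterclockwise order and chain i + 2 is the remaining one; i matters only
   modulo 3. *)
Definition chain (o : point R) (ch : nat -> point R) (i s : nat) : point R :=
  iter i (rot3 o) (ch s).

Definition subchain (P : pred nat) (o : point R) (ch : nat -> point R) (i : nat)
    (p : point R) : Prop :=
  exists2 s, P s & p = chain o ch i s.

(* "Convex to the right (left)" means that the chain, followed inwards from its
   convex hull vertex, turns right (left).  The hole between A and B is the place
   where the lines of [tc_CC_separate] and [tc_CC'_separate] cross the chain. *)
Record three_chain_spec (n : nat) (S : {fset point R}) (o : point R)
    (ch : nat -> point R) : Prop := ThreeChainSpec {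
  tc_points : forall p, p \in S <->
    exists i s, [/\ (i < 3)%N, in_chain n s & p = chain o ch i s];
  tc_card : #|` S| = n;
  tc_hull : forall i, hull_vertex S (chain o ch i 0);
  tc_AB_convex : forall i s t u, (s < t < u)%N ->
    posAB n s -> posAB n t -> posAB n u ->
    right_of (chain o ch i s) (chain o ch i t) (chain o ch i u);
  tc_C_convex : forall i s t u, (s < t < u)%N ->
    posC n s -> posC n t -> posC n u ->
    left_of (chain o ch i s) (chain o ch i t) (chain o ch i u);
  tc_AB_next : forall i s t u, (s < t)%N ->
    posAB n s -> posAB n t -> in_chain n u ->
    right_of (chain o ch i s) (chain o ch i t) (chain o ch i.+1 u);
  tc_AB_C : forall i s t u, (s < t)%N ->
    posAB n s -> posAB n t -> posC n u ->
    left_of (chain o ch i s) (chain o ch i t) (chain o ch i u);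
  tc_AB_remaining : forall i s t u, (s < t)%N ->
    posAB n s -> posAB n t -> in_chain n u ->
    left_of (chain o ch i s) (chain o ch i t) (chain o ch i.+2 u);
  tc_CC_separate : forall i s t, (s < t)%N -> posC n s -> posC n t ->
    separates (chain o ch i s) (chain o ch i t)
      (subchain (posA n) o ch i) (subchain (posB n) o ch i);
  (* Lines spanned by points of two different subchains C: of any two chains one
     is the "remaining" chain of the other, and the line separates A and B in the
     latter.  The other conditions leave the side of C_{i+2} with respect to the
     lines A_i C_i (and B_i C_i when C is a single point) undetermined, and the
     edge counts depend on it. *)
  tc_CC'_separate : forall i s t, posC n s -> posC n t ->
    separates (chain o ch i s) (chain o ch i.+2 t)
      (subchain (posA n) o ch i) (subchain (posB n) o ch i);
  tc_CC_other : forall i s t u, (s < t)%N ->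
    posC n s -> posC n t -> posC n u ->
    right_of (chain o ch i s) (chain o ch i t) (chain o ch i.+1 u) /\
    right_of (chain o ch i s) (chain o ch i t) (chain o ch i.+2 u);
  tc_triangle : forall i s, posC n s ->
    let b := (3 * (n %/ 12)).-1 in
    in_triangle (chain o ch 0 b) (chain o ch 1 b) (chain o ch 2 b)
      (chain o ch i s)
}.

Definition three_chain_configuration (n : nat) (S : {fset point R}) : Prop :=
  [/\ (0 < n)%N, (12 %| n)%N & exists o ch, three_chain_spec n S o ch].

End ThreeChains.

Definition le_edges_lower_bound (n k : nat) : int :=
  (3 * 'C(k + 2, 2))%:Z
    + \sum_((n %/ 3)%N <= j < k.+1) (3 * j%:Z - n%:Z + 3).

(* Main.v *)
(* Write n = 12 m.  The hypotheses determine the orientation of every triple of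
   points: [chain_signs] lists the signs, up to a cyclic shift of the chains.
   The sides of the triples left open are fixed by Cramer's rule in the plane,
   starting from two facts: points of A or B in three different chains are
   counterclockwise (moving one of them outwards increases the area, and the
   innermost ones form an equilateral triangle), and hence, by the triangle
   condition, a line from A or B to A or B of the next chain leaves C to the left.
     Every edge count is then explicit.  For k = 4 m + a with a < m, put
   T = (a + 2 choose 2).  Per chain, the (<= k)-edges are: T edges inside A and B
   and T edges from C to A of the same chain; the edges from position s to
   position t of the next chain with s + t <= k, which are (k + 2 choose 2) - 2 T
   as both positions are below 4 m; and T edges from B to C of the previous
   chain. *)
Require Import Defs.
From mathcomp Require Import all_boot all_order all_algebra finmap reals.
From mathcomp Require Import zify ring lra.

Set Implicit Arguments.
Unset Strict Implicit.
Unset Printing Implicit Defensive.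

Import Order.TTheory GRing.Theory Num.Theory.

(** * Orientations in the plane *)

Section Orientation.
Variable R : realType.
Implicit Types o p q r c d x y z : point R.
Local Open Scope ring_scope.

Lemma orient_cyc p q r : orient p q r = orient q r p.
Proof. by rewrite /orient; ring. Qed.

Lemma orient_swap p q r : orient q p r = - orient p q r.
Proof. by rewrite /orient; ring. Qed.

Lemma orient_eq0 p q : (orient p q p = 0) * (orient p q q = 0).
Proof. by split; rewrite /orient; ring. Qed.

Lemma rot3_scale : (Num.sqrt 3%:R / 2%:R) * (Num.sqrt 3%:R / 2%:R) = 3%:R / 4%:R :> R.
Proof.
have s3 : Num.sqrt 3%:R ^+ 2 = 3%:R :> R by rewrite sqr_sqrtr.
by rewrite mulf_div -expr2 s3 -natrM.
Qed.

Lemma orient_rot3 o p q r :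
  orient (rot3 o p) (rot3 o q) (rot3 o r) = orient p q r.
Proof.
have := rot3_scale; rewrite /rot3 /=.
set h := Num.sqrt _ / _ => hh.
(* The factor [1 / 4 + h * h] is the determinant of the rotation matrix, equal to 1 by
   [rot3_scale]. *)
transitivity ((1 / 4%:R + h * h) * orient p q r).
  by rewrite /orient /=; field.
by rewrite hh; field.
Qed.

Lemma rot3_3 o p : rot3 o (rot3 o (rot3 o p)) = p.
Proof.
have := rot3_scale; rewrite /rot3 /=.
set h := Num.sqrt _ / _ => hh; case: o p => [ox oy] [px py] /=.
have {}hh : h * h - 3%:R / 4%:R = 0 by rewrite hh subrr.
congr pair; apply/eqP; rewrite -subr_eq0; apply/eqP.
  transitivity ((h * h - 3%:R / 4%:R) * (3%:R / 2%:R * (px - ox) + h * (py - oy))).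
    by field.
  by rewrite hh mul0r.
transitivity ((h * h - 3%:R / 4%:R) * (3%:R / 2%:R * (py - oy) - h * (px - ox))).
  by field.
by rewrite hh mul0r.
Qed.

Lemma orient_rot3_gt0 o p : rot3 o p != p ->
  0 < orient p (rot3 o p) (rot3 o (rot3 o p)).
Proof.
move=> nz.
have h_gt0 : 0 < Num.sqrt 3%:R / 2%:R :> R by rewrite divr_gt0 ?sqrtr_gt0 ?ltr0n.
have r_gt0 : 0 < (p.1 - o.1) ^+ 2 + (p.2 - o.2) ^+ 2.
  rewrite lt0r addr_ge0 ?sqr_ge0 // andbT paddr_eq0 ?sqr_ge0 // !sqrf_eq0.
  apply: contra nz => /andP[/eqP x0 /eqP y0].
  rewrite /rot3 x0 y0 !(mul0r, mulr0, subr0, oppr0, addr0).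
  by rewrite -(subr0_eq x0) -(subr0_eq y0) -surjective_pairing.
set h := Num.sqrt _ / _ in h_gt0 *.
(* Since [h ^+ 2] is 3/4, this is [3 * h] times the squared circumradius: twice the area of an
   equilateral triangle. *)
have -> : orient p (rot3 o p) (rot3 o (rot3 o p))
    = h * (9%:R / 4%:R + h ^+ 2) * ((p.1 - o.1) ^+ 2 + (p.2 - o.2) ^+ 2).
  by rewrite /rot3 /orient /= -/h; field.
by apply: mulr_gt0 => //; apply: mulr_gt0 => //; rewrite ltr_wpDr ?sqr_ge0 ?divr_gt0 ?ltr0n.
Qed.

(** The difference of the two areas is [orient p p' q - orient p p' r], which is negative. *)
Lemma orient_outward p p' q r :
  orient p p' q < 0 -> 0 < orient p p' r -> orient p' q r < orient p q r.
Proof. by rewrite /orient; lra. Qed.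

(** The three-term Grassmann-Plücker relation for the vectors from [c]. The three sign lemmas below
    are the cases where both terms push the right-hand side the same way, so that the side of [z] on
    the line [c d] is read off from other lines through [c]. *)
Lemma orient_cramer c d z x y :
  orient c d z * orient c x y
  = orient c d x * orient c z y - orient c d y * orient c z x.
Proof. by rewrite /orient; ring. Qed.

Lemma cramer_gt0 c d z x y :
  0 < orient c x y -> 0 < orient c d x -> orient c d y < 0 ->
  0 < orient c z y -> 0 < orient c z x -> 0 < orient c d z.
Proof.
move=> h hx hy zy zx; rewrite -(pmulr_lgt0 _ h) orient_cramer.
by rewrite subr_gt0 (@lt_trans _ _ 0) ?nmulr_rlt0 ?mulr_gt0.
Qed.

Lemma cramer_lt0 c d z x y :
  0 < orient c x y -> 0 < orient c d x -> orient c d y < 0 ->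
  orient c z y < 0 -> orient c z x < 0 -> orient c d z < 0.
Proof.
move=> h hx hy zy zx; rewrite -(pmulr_llt0 _ h) orient_cramer.
by rewrite subr_lt0 (@lt_trans _ _ 0) ?nmulr_rgt0 ?pmulr_rlt0.
Qed.

Lemma cramerN_gt0 c d z x y :
  0 < orient c x y -> orient c d x < 0 -> 0 < orient c d y ->
  orient c z y < 0 -> orient c z x < 0 -> 0 < orient c d z.
Proof.
move=> h hx hy zy zx; rewrite -(pmulr_lgt0 _ h) orient_cramer.
by rewrite subr_gt0 (@lt_trans _ _ 0) ?pmulr_rlt0 // nmulr_rgt0.
Qed.

(** The signed areas of the four triples are the coefficients of the affine dependency of [p], [b],
    [c], [d], here applied to the affine function [orient q q']. *)
Lemma orient_dependency p b c d q q' :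
  orient b c d * orient q q' p - orient p c d * orient q q' b
  + orient p b d * orient q q' c - orient p b c * orient q q' d = 0.
Proof. by rewrite /orient; ring. Qed.

(** [orient p q] is affine. Two inequalities are weak because [p] and [q] may themselves be the
    vertices [u] and [v]. *)
Lemma orient_triangle p q u v w x : in_triangle u v w x ->
  0 <= orient p q u -> 0 <= orient p q v -> 0 < orient p q w ->
  0 < orient p q x.
Proof.
case=> a [b [c [a0 b0 c0 abc ->]]] hu hv hw.
suff -> : orient p q (a * u.1 + b * v.1 + c * w.1, a * u.2 + b * v.2 + c * w.2)
    = a * orient p q u + b * orient p q v + c * orient p q w.
  by rewrite ltr_wpDl ?addr_ge0 ?mulr_ge0 ?mulr_gt0 // ltW.
have {abc}-> : c = 1 - a - b by rewrite -abc; ring.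
by rewrite /orient /=; ring.
Qed.

Lemma in_triangle_cyc u v w x : in_triangle u v w x -> in_triangle v w u x.
Proof.
case=> a [b [c [a0 b0 c0 abc ->]]]; exists b, c, a; split=> //.
  by rewrite -abc; ring.
by congr pair; ring.
Qed.

End Orientation.

(** * The order type of the configuration *)

(* [P i s] is the point at position [s] of chain [i], the chains being indexed
   modulo 3; A, B and C occupy the positions from 0, 2m and 3m on. *)
Record chain_signs (R : realType) (m : nat) (P : nat -> nat -> point R) : Prop :=
  ChainSigns {
  same_chain_sign : forall i s t u, s < t -> t < u -> u < 4 * m ->
    if (u < 3 * m) || (2 * m <= s < 3 * m) && (3 * m <= t)
    then (orient (P i s) (P i t) (P i u) < 0)%R
    else (0 < orient (P i s) (P i t) (P i u))%R;
  next_chain_sign : forall i s t u, s < t -> t < 4 * m -> u < 4 * m ->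
    (orient (P i s) (P i t) (P i.+1 u) < 0)%R;
  remaining_chain_sign : forall i s t u, s < t -> t < 4 * m -> u < 4 * m ->
    if [&& 2 * m <= s, 3 * m <= t & 3 * m <= u]
    then (orient (P i s) (P i t) (P i.+2 u) < 0)%R
    else (0 < orient (P i s) (P i t) (P i.+2 u))%R;
  three_chains_sign : forall i s t u, s < 4 * m -> t < 4 * m -> u < 4 * m ->
    (0 < orient (P i s) (P i.+1 t) (P i.+2 u))%R
}.

(** Tries a sign fact under the six permutations of its points, the odd ones reversing the sign. *)
Ltac orient_by tac := first
  [ tac | rewrite orient_cyc; tac | rewrite -orient_cyc; tac
  | rewrite orient_swap ?oppr_gt0 ?oppr_lt0;
    first [ tac | rewrite orient_cyc; tac | rewrite -orient_cyc; tac ] ].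

Section OrderType.
Variables (R : realType) (m : nat) (P : nat -> nat -> point R).
Local Open Scope ring_scope.

Local Notation b := (3 * m).-1.
Local Notation O i s j t l u := (orient (P i s) (P j t) (P l u)).
Local Notation isA s := (s < 2 * m)%N.
Local Notation isB s := (2 * m <= s < 3 * m)%N.
Local Notation isAB s := (s < 3 * m)%N.
Local Notation isC s := (3 * m <= s < 4 * m)%N.
Local Notation inP s := (s < 4 * m)%N.

(** These hypotheses transcribe [three_chain_spec] to an abstract family; the rotation itself
    survives only in [P3] and [P_innermost]. *)
Hypothesis m_gt0 : (0 < m)%N.
Hypothesis P3 : forall i s, P i.+3 s = P i s.
Hypothesis P_innermost : forall i, 0 < O i b i.+1 b i.+2 b.
Hypothesis P_triangle : forall i j s, isC s ->
  in_triangle (P i b) (P i.+1 b) (P i.+2 b) (P j s).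
Hypothesis P_AB_convex : forall i s t u, (s < t < u)%N -> isAB u ->
  O i s i t i u < 0.
Hypothesis P_C_convex : forall i s t u, (3 * m <= s)%N -> (s < t < u)%N ->
  inP u -> 0 < O i s i t i u.
Hypothesis P_AB_next : forall i s t u, (s < t)%N -> isAB t -> inP u ->
  O i s i t i.+1 u < 0.
Hypothesis P_AB_C : forall i s t u, (s < t)%N -> isAB t -> isC u ->
  0 < O i s i t i u.
Hypothesis P_AB_remaining : forall i s t u, (s < t)%N -> isAB t -> inP u ->
  0 < O i s i t i.+2 u.
Hypothesis P_CC_separate : forall i s t, (3 * m <= s)%N -> (s < t)%N -> inP t ->
  ((forall u, isA u -> 0 < O i s i t i u) /\ (forall u, isB u -> O i s i t i u < 0)) \/
  ((forall u, isA u -> O i s i t i u < 0) /\ (forall u, isB u -> 0 < O i s i t i u)).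
Hypothesis P_CC'_separate : forall i s t, isC s -> isC t ->
  ((forall u, isA u -> 0 < O i s i.+2 t i u) /\ (forall u, isB u -> O i s i.+2 t i u < 0)) \/
  ((forall u, isA u -> O i s i.+2 t i u < 0) /\ (forall u, isB u -> 0 < O i s i.+2 t i u)).
Hypothesis P_CC_next : forall i s t u, (3 * m <= s)%N -> (s < t)%N -> inP t ->
  isC u -> O i s i t i.+1 u < 0.
Hypothesis P_CC_remaining : forall i s t u, (3 * m <= s)%N -> (s < t)%N ->
  inP t -> isC u -> O i s i t i.+2 u < 0.

Ltac turn h :=
  let H := fresh in
  have H := h; rewrite ?P3 in H; orient_by ltac:(by apply: H; lia).

Lemma AB_outward i s s' t u : (s <= s')%N -> isAB s' -> inP t -> inP u ->
  0 < O i s' i.+1 t i.+2 u -> 0 < O i s i.+1 t i.+2 u.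
Proof.
rewrite leq_eqVlt => /predU1P[-> // | ss'] s'AB tP uP /lt_trans; apply.
by apply: orient_outward; [exact: P_AB_next | exact: P_AB_remaining].
Qed.

(** Starting from the innermost points of the three B's, each vertex in turn is moved outwards by
    [AB_outward]. *)
Lemma AB_AB_AB i s t u : isAB s -> isAB t -> isAB u ->
  0 < O i s i.+1 t i.+2 u.
Proof.
move=> sAB tAB uAB.
have bs : (s <= b)%N by lia.
have bt : (t <= b)%N by lia.
have bu : (u <= b)%N by lia.
have bAB : isAB b by lia.
apply: (AB_outward bs); [lia..|].
rewrite orient_cyc -(P3 i); apply: (AB_outward bt); [lia..|].
rewrite orient_cyc -(P3 i.+1); apply: (AB_outward bu); [lia..|].
rewrite !P3 -orient_cyc -orient_cyc.
exact: P_innermost.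
Qed.

(** No vertex of the triangle containing the C's is to the right of the line: the first two lie on
    it or to its left, and the third is strictly to the left by [AB_AB_AB]. The chain [j] of the C
    point is therefore arbitrary. *)
Lemma AB_AB_C i s t j u : isAB s -> isAB t -> isC u ->
  0 < O i s i.+1 t j u.
Proof.
move=> sAB tAB uC; apply: (orient_triangle (P_triangle i j uC)).
- have [->|sb] := eqVneq s b; first by rewrite orient_eq0.
  by apply: ltW; turn (@P_AB_next i s b t).
- have [->|tb] := eqVneq t b; first by rewrite orient_eq0.
  by apply: ltW; turn (@P_AB_remaining i.+1 t b s).
- by apply: AB_AB_AB => //; lia.
Qed.

(* In the excluded alternative, the affine dependency between the four points is
   violated by a line of the next chain, which has [P i.+2 t] on its right and the
   other three points on its left. *)
Lemma A_B_CC' i p a s t : isA p -> isB a -> isC s -> isC t ->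
  0 < O i p i s i.+2 t /\ O i a i s i.+2 t < 0.
Proof.
move=> pA aB sC tC.
have [[hA hB]|[hA hB]] := P_CC'_separate i sC tC.
  by split; [turn (hA p) | turn (hB a)].
(* Positions 0 and 1 are both in A, as [2 * m] is at least 2. *)
have q0 u : inP u -> 0 < O i.+1 0 i.+1 1 i u.
  by move=> uP; turn (@P_AB_remaining i.+1 0 1 u).
have q2 : O i.+1 0 i.+1 1 i.+2 t < 0 by apply: P_AB_next; lia.
have pac : 0 < O i p i a i s by apply: P_AB_C; lia.
have pad : 0 < O i p i a i.+2 t by apply: P_AB_remaining; lia.
have pcd : O i p i s i.+2 t < 0 by turn (hA p).
have acd : 0 < O i a i s i.+2 t by turn (hB a).
have qp : 0 < O i.+1 0 i.+1 1 i p by apply: q0; lia.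
have qa : 0 < O i.+1 0 i.+1 1 i a by apply: q0; lia.
have qc : 0 < O i.+1 0 i.+1 1 i s by apply: q0; lia.
(* All four signed terms of the dependency are positive, yet they sum to 0. *)
have := orient_dependency (P i p) (P i a) (P i s) (P i.+2 t) (P i.+1 0) (P i.+1 1).
have := mulr_gt0 acd qp; have := mulr_gt0 pad qc.
have := nmulr_rlt0 (O i.+1 0 i.+1 1 i a) pcd; rewrite qa.
have := pmulr_rlt0 (O i.+1 0 i.+1 1 i.+2 t) pac; rewrite q2.
by lra.
Qed.

(** The outermost points of A and B serve as [x] and [y] in Cramer's rule. *)
Let isA0 : isA 0. Proof. by lia. Qed.
Let isB2m : isB (2 * m). Proof. by lia. Qed.

(** Cramer's rule at the C point of chain [i.+1]: the line to the other C point has A and B of that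
    chain on opposite sides, and the lines to A and B are settled by [AB_AB_C]. The next lemmas
    follow the same scheme. *)
Lemma AB_C_C' i p s t : isAB p -> isC s -> isC t -> O i p i s i.+1 t < 0.
Proof.
move=> pAB sC tC.
have [hA hB] := A_B_CC' i.+1 isA0 isB2m tC sC; rewrite !P3 in hA hB.
have h : 0 < O i.+1 t i s i p.
  apply: (@cramer_gt0 _ _ _ _ (P i.+1 0) (P i.+1 (2 * m))).
  - by turn (@P_AB_C i.+1 0 (2 * m) t).
  - by turn hA.
  - by turn hB.
  - by turn (@AB_AB_C i p (2 * m) i.+1 t).
  - by turn (@AB_AB_C i p 0 i.+1 t).
by turn h.
Qed.

Lemma AB_C'_C'' i p s t : isAB p -> isC s -> isC t -> 0 < O i p i.+1 s i.+2 t.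
Proof.
move=> pAB sC tC.
have [hA hB] := A_B_CC' i.+2 isA0 isB2m tC sC; rewrite !P3 in hA hB.
have h : O i.+2 t i.+1 s i p < 0.
  apply: (@cramer_lt0 _ _ _ _ (P i.+2 0) (P i.+2 (2 * m))).
  - by turn (@P_AB_C i.+2 0 (2 * m) t).
  - by turn hA.
  - by turn hB.
  - by turn (@AB_AB_C i.+2 (2 * m) p i.+2 t).
  - by turn (@AB_AB_C i.+2 0 p i.+2 t).
by turn h.
Qed.

Lemma C_C'_C'' i s t u : isC s -> isC t -> isC u -> 0 < O i s i.+1 t i.+2 u.
Proof.
move=> sC tC uC.
have [hA hB] := A_B_CC' i.+1 isA0 isB2m tC sC; rewrite !P3 in hA hB.
have h : O i.+1 t i s i.+2 u < 0.
  apply: (@cramer_lt0 _ _ _ _ (P i.+1 0) (P i.+1 (2 * m))).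
  - by turn (@P_AB_C i.+1 0 (2 * m) t).
  - by turn hA.
  - by turn hB.
  - by turn (@AB_C_C' i.+1 (2 * m) t u).
  - by turn (@AB_C_C' i.+1 0 t u).
by turn h.
Qed.

(* The excluded alternative would put the B of the next chain to the left of the
   line, and then also the C of the next chain. *)
Lemma A_B_CC i p a s t : isA p -> isB a -> (3 * m <= s)%N -> (s < t)%N -> inP t ->
  0 < O i p i s i t /\ O i a i s i t < 0.
Proof.
move=> pA aB sC st tC.
have [[hA hB]|[hA hB]] := P_CC_separate i sC st tC.
  by split; [turn (hA p) | turn (hB a)].
have sC' : isC s by lia.
pose q := (2 * m)%N.
have hq : 0 < O i s i t i.+1 q.
  apply: (@cramerN_gt0 _ _ _ _ (P i p) (P i a)).
  - by turn (@P_AB_C i p a s).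
  - by turn (hA p).
  - by turn (hB a).
  - by turn (@AB_AB_C i a q i s).
  - by turn (@AB_AB_C i p q i s).
have [_ hB'] := A_B_CC' i.+1 isA0 isB2m sC' sC'; rewrite !P3 -/q in hB'.
have := @P_CC_next i s t s sC st tC sC'.
(* Position [s] of the next chain is a C point, which [P_CC_next] places on the right; Cramer's rule
   with [a] and [q] places it on the left. *)
suff : 0 < O i s i t i.+1 s by move=> /lt_trans h /h; rewrite ltxx.
have saq : 0 < O i s i a i.+1 q by turn (@AB_AB_C i a q i s).
rewrite -(pmulr_lgt0 _ saq) orient_cramer subr_gt0.
have ssq : 0 < O i s i.+1 s i.+1 q by turn hB'.
have ssa : O i s i.+1 s i a < 0 by turn (@AB_C_C' i a s s).
have sta : 0 < O i s i t i a by turn (hB a).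
by rewrite (@lt_trans _ _ 0) ?mulr_gt0 ?pmulr_rlt0.
Qed.

Lemma AB_C_AB' i p s q : isAB p -> isC s -> isAB q -> O i p i s i.+1 q < 0.
Proof. by move=> pAB sC qAB; turn (@AB_AB_C i p q i s). Qed.

Lemma AB_C_AB'' i p s r : isAB p -> isC s -> isAB r -> 0 < O i p i s i.+2 r.
Proof. by move=> pAB sC rAB; turn (@AB_AB_C i.+2 r p i s). Qed.

Lemma C_C_AB' i s t q : (3 * m <= s)%N -> (s < t)%N -> inP t -> isAB q ->
  O i s i t i.+1 q < 0.
Proof.
move=> sC st tC qAB.
have [hA hB] := A_B_CC i isA0 isB2m sC st tC.
apply: (@cramer_lt0 _ _ _ _ (P i 0) (P i (2 * m))).
- by turn (@P_AB_C i 0 (2 * m) s).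
- by turn hA.
- by turn hB.
- by turn (@AB_AB_C i (2 * m) q i s).
- by turn (@AB_AB_C i 0 q i s).
Qed.

Lemma C_C_AB'' i s t r : (3 * m <= s)%N -> (s < t)%N -> inP t -> isAB r ->
  0 < O i s i t i.+2 r.
Proof.
move=> sC st tC rAB.
have [hA hB] := A_B_CC i isA0 isB2m sC st tC.
apply: (@cramer_gt0 _ _ _ _ (P i 0) (P i (2 * m))).
- by turn (@P_AB_C i 0 (2 * m) s).
- by turn hA.
- by turn hB.
- by turn (@AB_AB_C i.+2 r (2 * m) i s).
- by turn (@AB_AB_C i.+2 r 0 i s).
Qed.

Lemma same_chain_orient i s t u : (s < t)%N -> (t < u)%N -> inP u ->
  if (u < 3 * m)%N || (isB s && (3 * m <= t)%N)
  then O i s i t i u < 0 else 0 < O i s i t i u.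
Proof.
move=> st tu uP.
have [uAB|uC] /= := ltnP u (3 * m); first by apply: P_AB_convex; lia.
have [tAB|tC] /= := ltnP t (3 * m).
  by rewrite andbF; apply: P_AB_C; lia.
rewrite andbT.
have [sA|sB] /= := ltnP s (2 * m).
  by have [+ _] := A_B_CC i sA isB2m tC tu uP.
have [sAB|sC] /= := ltnP s (3 * m).
  have aB : isB s by lia.
  by have [_ +] := A_B_CC i isA0 aB tC tu uP.
by apply: P_C_convex; lia.
Qed.

Lemma next_chain_orient i s t u : (s < t)%N -> inP t -> inP u ->
  O i s i t i.+1 u < 0.
Proof.
move=> st tP uP.
have [tAB|tC] := ltnP t (3 * m); first exact: P_AB_next.
have [uAB|uC] := ltnP u (3 * m); have [sAB|sC] := ltnP s (3 * m).
- by apply: AB_C_AB'; lia.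
- exact: C_C_AB'.
- by apply: AB_C_C'; lia.
- by apply: P_CC_next; lia.
Qed.

Lemma remaining_chain_orient i s t u : (s < t)%N -> inP t -> inP u ->
  if [&& 2 * m <= s, 3 * m <= t & 3 * m <= u]%N
  then O i s i t i.+2 u < 0 else 0 < O i s i t i.+2 u.
Proof.
move=> st tP uP.
have [tAB|tC] := ltnP t (3 * m).
  by rewrite andbF; apply: P_AB_remaining.
have [uAB|uC] := ltnP u (3 * m); have [sAB|sC] := ltnP s (3 * m).
- by rewrite /= andbF; apply: AB_C_AB''; lia.
- by rewrite /= andbF; apply: C_C_AB''.
- have tC' : isC t by lia.
  have uC' : isC u by lia.
  have [sA|sB] /= := ltnP s (2 * m).
    by have [+ _] := A_B_CC' i sA isB2m tC' uC'.
  have aB : isB s by lia.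
  by have [_ +] := A_B_CC' i isA0 aB tC' uC'.
- by rewrite (_ : 2 * m <= s)%N /=; [apply: P_CC_remaining; lia | lia].
Qed.

Lemma three_chains_orient i s t u : inP s -> inP t -> inP u ->
  0 < O i s i.+1 t i.+2 u.
Proof.
move=> sP tP uP.
have [sAB|sC] := ltnP s (3 * m); have [tAB|tC] := ltnP t (3 * m);
  have [uAB|uC] := ltnP u (3 * m).
- exact: AB_AB_AB.
- by apply: AB_AB_C; lia.
- by turn (@AB_AB_C i.+2 u s i.+1 t).
- by apply: AB_C'_C''; lia.
- by turn (@AB_AB_C i.+1 t u i s).
- by turn (@AB_C'_C'' i.+1 t u s).
- by turn (@AB_C'_C'' i.+2 u s t).
- by apply: C_C'_C''; lia.
Qed.

Lemma chain_signsP : chain_signs m P.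
Proof.
split; [exact: same_chain_orient | exact: next_chain_orient
  | exact: remaining_chain_orient | exact: three_chains_orient].
Qed.

End OrderType.

(** * Counting edges *)

(** Every set of positions counted exactly below is a union of at most two intervals, possibly
    empty. *)
Lemma sum_itv2 N a b c d (Q : nat -> bool) : a <= b -> b <= c -> c <= d -> d <= N ->
  (forall u, u < N -> Q u = (a <= u < b) || (c <= u < d)) ->
  \sum_(u < N) Q u = (b - a) + (d - c).
Proof.
move=> ab bc cd dN QE.
under eq_bigr do rewrite QE //; clear Q QE.
elim: N a b c d ab bc cd dN => [|N IH] a b c d ab bc cd dN.
  by rewrite big_ord0; lia.
rewrite big_ord_recl /= (eq_bigr (fun u : 'I_N =>
  nat_of_bool ((a.-1 <= u < b.-1) || (c.-1 <= u < d.-1)))).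
  by rewrite IH; lia.
by move=> u _; rewrite /bump /=; lia.
Qed.

(** Under truncated subtraction the whole sequence [c - s] sums to a triangular number; the terms
    from [N] on form the smaller one. *)
Lemma sum_sub N c : \sum_(s < N) (c - s) + 'C(c - N + 1, 2) = 'C(c + 1, 2).
Proof.
elim: N c => [|N IH] c; first by rewrite big_ord0 subn0.
rewrite big_ord_recl subn0.
case: c => [|c]; first by rewrite big1.
rewrite (eq_bigr (fun s : 'I_N => c - s)) => [|s _]; last by rewrite lift0.
by have := IH c; rewrite subSS !addn1 (binS c.+1) bin1 => <-; rewrite -addnA addnC.
Qed.

Lemma sum_sub_small N c : c <= N -> \sum_(s < N) (c - s) = 'C(c + 1, 2).
Proof. by move=> /eqP cN; rewrite -(sum_sub N c) cN addn0. Qed.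

Lemma sum_sub_rev N c : c <= N -> \sum_(s < N) (c - (N - 1 - s)) = 'C(c + 1, 2).
Proof.
move=> cN; rewrite -(sum_sub_small cN) (reindex_inj rev_ord_inj) /=.
by apply: eq_bigr => s _; congr subn; have := ltn_ord s; lia.
Qed.

Section Counts.
Variables (R : realType) (m : nat) (P : nat -> nat -> point R).

Local Notation isB s := (2 * m <= s < 3 * m)%N.
Local Notation inP s := (s < 4 * m)%N.

Hypothesis m_gt0 : (0 < m)%N.
Hypothesis P3 : forall i s, P i.+3 s = P i s.
Hypothesis signs : chain_signs m P.

Definition num_right p q i : nat := \sum_(u < 4 * m) right_of p q (P i u).

Definition rcount p q : nat := num_right p q 0 + num_right p q 1 + num_right p q 2.

Lemma rcountE i p q :
  rcount p q = num_right p q i + num_right p q i.+1 + num_right p q i.+2.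
Proof.
elim: i => // i ->; rewrite [num_right p q i.+3](_ : _ = num_right p q i); first by lia.
by apply: eq_bigr => u _; rewrite P3.
Qed.

Definition same_neg s t u := (u < 3 * m) || (isB s && (3 * m <= t)).
Definition rem_neg s t u := [&& 2 * m <= s, 3 * m <= t & 3 * m <= u].

Lemma same_right i s t u : s < t -> t < u -> inP u ->
  (right_of (P i s) (P i t) (P i u) = same_neg s t u) *
  (left_of (P i s) (P i t) (P i u) = ~~ same_neg s t u).
Proof.
move=> st tu uP; have := same_chain_sign signs i st tu uP.
by rewrite /same_neg /right_of /left_of; case: ifP => _ h; rewrite h lt_gtF.
Qed.

Lemma remaining_right i s t u : s < t -> inP t -> inP u ->
  (right_of (P i s) (P i t) (P i.+2 u) = rem_neg s t u) *
  (left_of (P i s) (P i t) (P i.+2 u) = ~~ rem_neg s t u).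
Proof.
move=> st tP uP; have := remaining_chain_sign signs i st tP uP.
by rewrite /rem_neg /right_of /left_of; case: ifP => _ h; rewrite h lt_gtF.
Qed.

Lemma right_cyc (p q r : point R) : right_of p q r = right_of q r p.
Proof. by rewrite /right_of orient_cyc. Qed.

Lemma left_cyc (p q r : point R) : left_of p q r = left_of q r p.
Proof. by rewrite /left_of orient_cyc. Qed.

Lemma right_swap (p q r : point R) : right_of q p r = left_of p q r.
Proof. by rewrite /right_of /left_of orient_swap oppr_lt0. Qed.

Lemma left_swap (p q r : point R) : left_of q p r = right_of p q r.
Proof. by rewrite /right_of /left_of orient_swap oppr_gt0. Qed.

Lemma right_refl (p q : point R) : (right_of p q p = false) * (right_of p q q = false).
Proof. by rewrite /right_of !orient_eq0 ltxx. Qed.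

Lemma same_rightE i s t u : s < t -> inP t -> inP u ->
  (right_of (P i s) (P i t) (P i u) =
    [|| (u < s) && same_neg u s t, [&& s < u, u < t & ~~ same_neg s u t]
      | (t < u) && same_neg s t u]) *
  (right_of (P i t) (P i s) (P i u) =
    [|| (u < s) && ~~ same_neg u s t, [&& s < u, u < t & same_neg s u t]
      | (t < u) && ~~ same_neg s t u]).
Proof.
move=> st tP uP.
rewrite (right_swap (P i s) (P i t)).
have ts : (t < s) = false by lia.
have [us|su|->] := ltngtP u s; last first.
  by rewrite ts /= /left_of right_refl orient_eq0 ltxx; split.
all: have [ut|tu|etu] := ltngtP u t; rewrite /= ?orbF.
- by rewrite -right_cyc right_swap -(left_cyc (P i u)) (left_swap (P i s)) !same_right.
- by rewrite !same_right.
- by rewrite etu /left_of right_refl orient_eq0 ltxx; split.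
- by rewrite -right_cyc -left_cyc !same_right.
- by lia.
- by lia.
Qed.

Lemma num_rightE a b c d i p q : a <= b -> b <= c -> c <= d -> d <= 4 * m ->
  (forall u, inP u -> right_of p q (P i u) = (a <= u < b) || (c <= u < d)) ->
  num_right p q i = (b - a) + (d - c).
Proof.
move=> *; rewrite /num_right.
by rewrite (@sum_itv2 _ a b c d (fun u => right_of p q (P i u))).
Qed.

Lemma num_right_ge a i p q : a <= 4 * m ->
  (forall u, u < a -> right_of p q (P i u)) -> a <= num_right p q i.
Proof.
move=> am h; rewrite -{1}[a](_ : \sum_(u < 4 * m) (u < a) = a).
  by apply: leq_sum => u _; case: ltnP => // /h ->.
by rewrite (@sum_itv2 _ 0 a a a (fun u => u < a)) ?subnn ?addn0 ?subn0 // => u _; lia.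
Qed.

Variable a : nat.
Hypothesis a_lt_m : a < m.

(** Going inwards, the next chain alone contributes [4 * m], which leaves [a]: such edges go from A
    to B. Going outwards, they go from C to A, with the whole chain [i.+2] on the right. In every
    other case the count is at least [5 * m]. *)
Lemma rcount_same_le i s t : s < t -> inP t ->
  ((rcount (P i s) (P i t) <= 4 * m + a) = (s + 3 * m <= t + 1 + a) && (t < 3 * m)) *
  ((rcount (P i t) (P i s) <= 4 * m + a) = (s + (4 * m - 1 - t) <= a)).
Proof.
move=> st tP.
have n1 : num_right (P i s) (P i t) i.+1 = 4 * m.
  rewrite (@num_rightE 0 0 0 (4 * m)) //; first by lia.
  by move=> u uP; rewrite /right_of (next_chain_sign signs) //; lia.
have n1' : num_right (P i t) (P i s) i.+1 = 0.
  rewrite (@num_rightE 0 0 0 0) // => u uP.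
  by rewrite right_swap /left_of lt_gtF ?(next_chain_sign signs) //; lia.
pose c2 := (2 * m <= s) && (3 * m <= t).
have n2 : num_right (P i s) (P i t) i.+2 = if c2 then m else 0.
  rewrite /c2; case: ifP => h.
    rewrite (@num_rightE 0 0 (3 * m) (4 * m)); try lia.
    by move=> u uP; rewrite remaining_right /rem_neg //; lia.
  rewrite (@num_rightE 0 0 0 0) // => u uP.
  by rewrite remaining_right /rem_neg //; lia.
have n2' : num_right (P i t) (P i s) i.+2 = if c2 then 3 * m else 4 * m.
  rewrite /c2; case: ifP => h.
    rewrite (@num_rightE 0 0 0 (3 * m)); try lia.
    by move=> u uP; rewrite right_swap remaining_right /rem_neg //; lia.
  rewrite (@num_rightE 0 0 0 (4 * m)) //; first lia.
  by move=> u uP; rewrite right_swap remaining_right /rem_neg //; lia.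
rewrite !(rcountE i) n1 n1' n2 n2' /c2.
have self u := @same_rightE i s t u st tP.
have [tAB|tC] := ltnP t (3 * m).
  have -> : num_right (P i s) (P i t) i = (s - 0) + (3 * m - t.+1).
    by apply: num_rightE; try lia; move=> u uP; rewrite self // /same_neg; lia.
  have -> : num_right (P i t) (P i s) i = (t - s.+1) + (4 * m - 3 * m).
    by apply: num_rightE; try lia; move=> u uP; rewrite self // /same_neg; lia.
  by rewrite andbF; split; lia.
have [sA|sB] := ltnP s (2 * m).
  have -> : num_right (P i s) (P i t) i = (0 - 0) + (t - s.+1).
    by apply: num_rightE; try lia; move=> u uP; rewrite self // /same_neg; lia.
  have -> : num_right (P i t) (P i s) i = (s - 0) + (4 * m - t.+1).
    by apply: num_rightE; try lia; move=> u uP; rewrite self // /same_neg; lia.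
  by rewrite /=; split; lia.
have [sAB|sC] := ltnP s (3 * m).
  have -> : num_right (P i s) (P i t) i = (3 * m - s.+1) + (4 * m - t.+1).
    by apply: num_rightE; try lia; move=> u uP; rewrite self // /same_neg; lia.
  have -> : num_right (P i t) (P i s) i = (s - 0) + (t - 3 * m).
    by apply: num_rightE; try lia; move=> u uP; rewrite self // /same_neg; lia.
  by rewrite /=; split; lia.
have -> : num_right (P i s) (P i t) i = (3 * m - 2 * m) + (t - s.+1).
  by apply: num_rightE; try lia; move=> u uP; rewrite self // /same_neg; lia.
(* A bound suffices: A gives [2 * m] points and chain [i.+2] another [3 * m], which already exceeds
   [4 * m + a]. *)
have : 2 * m <= num_right (P i t) (P i s) i.
  by apply: num_right_ge; [lia | move=> u uP; rewrite self /same_neg; lia].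
by rewrite /=; split; lia.
Qed.

Lemma next_right i s t u : inP s -> inP t -> inP u ->
  (right_of (P i s) (P i.+1 t) (P i u) = (u < s)) *
  (right_of (P i.+1 t) (P i s) (P i u) = (s < u)).
Proof.
move=> sP tP uP; have [us|su|->] := ltngtP u s.
- have h := next_chain_sign signs i us sP tP.
  by rewrite -right_cyc (right_swap (P i s) (P i.+1 t)) -left_cyc /right_of /left_of h lt_gtF.
- have h := next_chain_sign signs i su uP tP.
  by rewrite -right_cyc right_swap right_cyc /right_of /left_of h lt_gtF.
- by rewrite !right_refl.
Qed.

Lemma next_right' i s t u : inP s -> inP t -> inP u ->
  (right_of (P i s) (P i.+1 t) (P i.+1 u) =
    ((u < t) && ~~ rem_neg u t s) || ((t < u) && rem_neg t u s)) *
  (right_of (P i.+1 t) (P i s) (P i.+1 u) =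
    ((u < t) && rem_neg u t s) || ((t < u) && ~~ rem_neg t u s)).
Proof.
move=> sP tP uP; have [ut|tu|->] := ltngtP u t; rewrite /= ?orbF.
- have h := @remaining_right i.+1 u t s ut tP sP; rewrite P3 in h.
  by rewrite right_cyc right_swap h -right_cyc h.
- have h := @remaining_right i.+1 t u s tu uP sP; rewrite P3 in h.
  by rewrite right_cyc h (right_swap (P i s)) left_cyc h.
- by rewrite !right_refl.
Qed.

(** The forward count is [s + t] unless [s] is in C and [t] in B or C; then both it and [s + t] are
    at least [5 * m], so the criterion is unaffected. A backward edge has all of chain [i.+2] on its
    right, and only the direction from B to C leaves few enough others. *)
Lemma rcount_next_le i s t : inP s -> inP t ->
  ((rcount (P i s) (P i.+1 t) <= 4 * m + a) = (s + t <= 4 * m + a)) *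
  ((rcount (P i.+1 t) (P i s) <= 4 * m + a)
    = (t < 3 * m) && ((4 * m - 1 - s) + (3 * m - 1 - t) <= a)).
Proof.
move=> sP tP; rewrite !(rcountE i).
have -> : num_right (P i s) (P i.+1 t) i = (0 - 0) + (s - 0).
  by apply: num_rightE; try lia; move=> u uP; rewrite next_right.
have -> : num_right (P i.+1 t) (P i s) i = (0 - 0) + (4 * m - s.+1).
  by apply: num_rightE; try lia; move=> u uP; rewrite next_right //; lia.
have -> : num_right (P i s) (P i.+1 t) i.+2 = (0 - 0) + (0 - 0).
  apply: num_rightE; try lia; move=> u uP.
  by rewrite /right_of lt_gtF ?(three_chains_sign signs); lia.
have -> : num_right (P i.+1 t) (P i s) i.+2 = (0 - 0) + (4 * m - 0).
  apply: num_rightE; try lia; move=> u uP.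
  by rewrite right_swap /left_of (three_chains_sign signs) //; lia.
have self u := @next_right' i s t u sP tP.
have [tA|tB] := ltnP t (2 * m); last have [sAB|sC] := ltnP s (3 * m).
- have -> : num_right (P i s) (P i.+1 t) i.+1 = (0 - 0) + (t - 0).
    by apply: num_rightE; try lia; move=> u uP; rewrite self // /rem_neg; lia.
  have -> : num_right (P i.+1 t) (P i s) i.+1 = (0 - 0) + (4 * m - t.+1).
    by apply: num_rightE; try lia; move=> u uP; rewrite self // /rem_neg; lia.
  by rewrite /=; split; lia.
- have -> : num_right (P i s) (P i.+1 t) i.+1 = (0 - 0) + (t - 0).
    by apply: num_rightE; try lia; move=> u uP; rewrite self // /rem_neg; lia.
  have -> : num_right (P i.+1 t) (P i s) i.+1 = (0 - 0) + (4 * m - t.+1).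
    by apply: num_rightE; try lia; move=> u uP; rewrite self // /rem_neg; lia.
  by rewrite /=; split; lia.
have [tAB|tC] := ltnP t (3 * m).
  have -> : num_right (P i s) (P i.+1 t) i.+1 = (t - 0) + (4 * m - 3 * m).
    by apply: num_rightE; try lia; move=> u uP; rewrite self // /rem_neg; lia.
  have -> : num_right (P i.+1 t) (P i s) i.+1 = (0 - 0) + (3 * m - t.+1).
    by apply: num_rightE; try lia; move=> u uP; rewrite self // /rem_neg; lia.
  by rewrite /=; split; lia.
have -> : num_right (P i s) (P i.+1 t) i.+1 = (2 * m - 0) + (4 * m - t.+1).
  by apply: num_rightE; try lia; move=> u uP; rewrite self // /rem_neg; lia.
have -> : num_right (P i.+1 t) (P i s) i.+1 = (0 - 0) + (t - 2 * m).
  by apply: num_rightE; try lia; move=> u uP; rewrite self // /rem_neg; lia.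
by rewrite /=; split; lia.
Qed.

Lemma same_neq i s t : s < t -> inP t -> (P i s == P i t) = false.
Proof.
move=> st tP; apply/negP => /eqP e.
have := @next_chain_sign _ _ _ signs i s t t st tP tP.
by rewrite e -orient_cyc orient_eq0 ltxx.
Qed.

Lemma next_neq i s t : inP s -> inP t -> (P i s == P i.+1 t) = false.
Proof.
move=> sP tP; apply/negP => /eqP e.
have := @three_chains_sign _ _ _ signs i s t t sP tP tP.
by rewrite e -orient_cyc orient_eq0 ltxx.
Qed.

Definition num_le i j : nat :=
  \sum_(s < 4 * m) \sum_(t < 4 * m)
    ((P i s != P j t) && (rcount (P i s) (P j t) <= 4 * m + a)).

Lemma num_le_same i : num_le i i = 2 * 'C(a + 2, 2).
Proof.
have a1 : a + 1 <= 4 * m by lia.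
have h1 := sum_sub_small a1; have h2 := sum_sub_rev a1; rewrite -addnA in h1 h2.
rewrite mul2n -addnn -{1}h1 -h2 -big_split /=; apply: eq_bigr => s _.
have sP := ltn_ord s.
(* For a fixed tail [s], the first interval holds the heads of outward edges and the second those of
   inward edges; [minn] makes the latter empty once [s] exceeds [a]. *)
rewrite (@sum_itv2 _ 0 (a + 1 - (4 * m - 1 - s)) (minn (3 * m) (s + 3 * m - 1 - a)) (3 * m)
  (fun t => (P i s != P i t) && (rcount (P i s) (P i t) <= 4 * m + a))); try lia.
move=> t tP; have [st|ts|->] := ltngtP s t.
- by rewrite same_neq // rcount_same_le //=; lia.
- by rewrite eq_sym same_neq // (rcount_same_le i ts sP).2 /=; lia.
- by rewrite eqxx; lia.
Qed.

(** The triangle of pairs with [s + t <= 4 * m + a] loses one corner to the bound on [t] and an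
    equal one to the bound on [s]; the latter is the correction term of [sum_sub]. *)
Lemma num_le_next i : num_le i i.+1 + 2 * 'C(a + 2, 2) = 'C(4 * m + a + 2, 2).
Proof.
have a1 : a + 1 <= 4 * m by lia.
have h1 := sum_sub_small a1; rewrite -addnA in h1.
have h2 := sum_sub (4 * m) (4 * m + a + 1).
rewrite (_ : 4 * m + a + 1 - 4 * m + 1 = a + 2) in h2; last lia.
rewrite (_ : 4 * m + a + 1 + 1 = 4 * m + a + 2) in h2; last lia.
rewrite -h2 mul2n -addnn addnA; congr addn.
rewrite -h1 /num_le -big_split /=; apply: eq_bigr => s _.
have sP := ltn_ord s.
rewrite (@sum_itv2 _ 0 0 0 (minn (4 * m) (4 * m + a + 1 - s))
  (fun t => (P i s != P i.+1 t) && (rcount (P i s) (P i.+1 t) <= 4 * m + a))); try lia.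
by move=> t tP; rewrite next_neq // rcount_next_le //; lia.
Qed.

Lemma num_le_prev i : num_le i.+1 i = 'C(a + 2, 2).
Proof.
have a1 : a + 1 <= 4 * m by lia.
have h1 := sum_sub_rev a1; rewrite -addnA in h1.
rewrite -h1 /num_le exchange_big /=.
apply: eq_bigr => s _; have sP := ltn_ord s.
rewrite (@sum_itv2 _ 0 0 (3 * m - (a + 1 - (4 * m - 1 - s))) (3 * m)
  (fun t => (P i.+1 t != P i s) && (rcount (P i.+1 t) (P i s) <= 4 * m + a))); try lia.
by move=> t tP; rewrite eq_sym next_neq // rcount_next_le //; lia.
Qed.

Lemma num_le_sum : \sum_(i < 3) \sum_(j < 3) num_le i j
  = 3 * 'C(4 * m + a + 2, 2) + 3 * 'C(a + 2, 2).
Proof.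
rewrite !big_ord_recl !big_ord0 /= /bump /= !add1n.
(* Chain 0 is read as chain 3, so that chains 2 and 0 become consecutive. *)
have e02 : num_le 0 2 = num_le 3 2.
  by apply: eq_bigr => s _; apply: eq_bigr => t _; rewrite P3.
have e20 : num_le 2 0 = num_le 2 3.
  by apply: eq_bigr => s _; apply: eq_bigr => t _; rewrite P3.
rewrite e02 e20 !num_le_same !num_le_prev.
by have := num_le_next 0; have := num_le_next 1; have := num_le_next 2; lia.
Qed.

End Counts.

(** * Edge numbers as sums over an enumeration of the point set *)

Lemma sum_eq_ord k r : \sum_(j < k) (r == j :> nat) = (r < k).
Proof.
elim: k => [|k IH]; first by rewrite big_ord0.
by rewrite big_ord_recr IH /=; lia.
Qed.

Lemma big_iota (F : nat -> nat) n : \sum_(i <- iota 0 n) F i = \sum_(i < n) F i.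
Proof. by rewrite -(big_mkord xpredT F) /index_iota subn0. Qed.

Lemma card_fset_filter (K : choiceType) (A : {fset K}) (L : seq K) (Q : pred K) :
  perm_eq A L -> #|` [fset x in A | Q x]%fset | = \sum_(x <- L) Q x.
Proof.
move=> AL; rewrite -(perm_big _ AL) /=.
transitivity (\sum_(x <- enum_fset A | Q x) 1).
  rewrite sum1_count -size_filter; apply/perm_size/uniq_perm.
  - exact: fset_uniq.
  - by rewrite filter_uniq ?fset_uniq.
  - by move=> x; rewrite mem_filter !inE andbC.
by rewrite big_mkcond; apply: eq_bigr => x _; case: (Q x).
Qed.

Lemma perm_fsetM (K : choiceType) (A : {fset K}) (L : seq K) :
  perm_eq A L -> perm_eq (A `*` A)%fset [seq (x, y) | x <- L, y <- L].
Proof.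
move=> AL; have Lu : uniq L by rewrite -(perm_uniq AL) fset_uniq.
apply: uniq_perm; first exact: fset_uniq.
  by apply: allpairs_uniq => // -[x y] [x' y'] _ _ [-> ->].
move=> [x y]; rewrite !inE /= !(perm_mem AL).
apply/andP/allpairsP => [[xL yL]|[[x' y'] /= [xL yL [-> ->]]] //].
by exists (x, y).
Qed.

(** An ordered pair of distinct points is a [j]-edge for exactly one [j], so summing over [j <= k]
    tests its right count against [k]. *)
Lemma num_le_edgesE (R : realType) (S : {fset point R}) (L : seq (point R)) k :
  perm_eq S L -> num_le_edges S k =
  \sum_(p <- L) \sum_(q <- L) ((p != q) && (\sum_(r <- L) right_of p q r <= k)).
Proof.
move=> SL; rewrite /num_le_edges /num_j_edges.
rewrite (eq_bigr _ (fun (j : 'I_k.+1) _ => card_fset_filter (j_edge S j) (perm_fsetM SL))).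
under eq_bigr do rewrite big_allpairs.
rewrite exchange_big /= big_seq [RHS]big_seq; apply: eq_bigr => p pL.
rewrite exchange_big /= big_seq [RHS]big_seq; apply: eq_bigr => q qL.
have inS x : x \in L -> x \in S by rewrite -(perm_mem SL).
under eq_bigr do rewrite /j_edge /= !inS //= (card_fset_filter (right_of p q) SL).
case: (p != q) => /=; last by rewrite big1.
exact: sum_eq_ord.
Qed.

(** * From the specification to the sign table and the final count *)

Section Main.
Variables (R : realType) (m : nat) (S : {fset point R}) (o : point R).
Variable ch : nat -> point R.
Hypothesis m_gt0 : 0 < m.
Hypothesis hS : three_chain_spec (12 * m) S o ch.

Local Notation P i s := (chain o ch i s).
Local Notation O i s j t l u := (orient (P i s) (P j t) (P l u)).

Let n12 : 12 * m %/ 12 = m. Proof. by rewrite mulKn. Qed.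

Lemma chain3 i s : P i.+3 s = P i s.
Proof. exact: rot3_3. Qed.

Definition chain_points := [seq P i s | i <- iota 0 3, s <- iota 0 (4 * m)].

Lemma mem_points p : (p \in S) = (p \in chain_points).
Proof.
apply/idP/allpairsP => [/(tc_points hS)[i [s [i3 sm ->]]]|[[i s] [i3 sm ->]]].
  exists (i, s); split=> [||//]; rewrite mem_iota //.
  by move: sm; rewrite /in_chain n12.
apply/(tc_points hS); exists i, s; split=> //; move: i3 sm; rewrite !mem_iota //.
by rewrite /in_chain n12.
Qed.

(** Pigeonhole: the list covers [S] and has exactly as many entries as [S] has points. *)
Lemma points_uniq : uniq chain_points.
Proof.
apply: (@leq_size_uniq _ (enum_fset S)); first exact: fset_uniq.
  by move=> p; rewrite -mem_points.
by rewrite size_allpairs !size_iota mulnA (tc_card hS).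
Qed.

Lemma perm_points : perm_eq S chain_points.
Proof. exact: uniq_perm (fset_uniq _) points_uniq mem_points. Qed.

Lemma orient_chainS i s j t l u : O i.+1 s j.+1 t l.+1 u = O i s j t l u.
Proof. exact: orient_rot3. Qed.

(** The three points form an equilateral triangle, nondegenerate because a fixed point of the
    rotation would occur in both chain 0 and chain 1, against [points_uniq]. *)
Lemma chain_gt0 i s : s < 4 * m -> (0 < O i s i.+1 s i.+2 s)%R.
Proof.
move=> sm; elim: i => [|i IH]; last by rewrite orient_chainS.
apply: orient_rot3_gt0; apply/negP => /eqP e.
have := points_uniq; rewrite /chain_points /= cat_uniq => /and3P[_ /hasPn /(_ (P 1 s))].
have h i : P i s \in [seq P i s | s <- iota 0 (4 * m)].
  by apply/mapP; exists s => //; rewrite mem_iota.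
by rewrite mem_cat h => /(_ isT) /negP[]; rewrite [P 1 s]e h.
Qed.

Lemma in_triangle_chain i j s : 3 * m <= s < 4 * m ->
  in_triangle (P i (3 * m).-1) (P i.+1 (3 * m).-1) (P i.+2 (3 * m).-1) (P j s).
Proof.
move=> sC; elim: i => [|i IH]; last by rewrite chain3; exact: in_triangle_cyc.
by have := tc_triangle hS j (s := s); rewrite /posC n12; apply.
Qed.

Lemma separates_AB p q i :
  separates p q (subchain (posA (12 * m)) o ch i) (subchain (posB (12 * m)) o ch i) ->
  ((forall u, u < 2 * m -> (0 < orient p q (P i u))%R) /\
   (forall u, 2 * m <= u < 3 * m -> (orient p q (P i u) < 0)%R)) \/
  ((forall u, u < 2 * m -> (orient p q (P i u) < 0)%R) /\
   (forall u, 2 * m <= u < 3 * m -> (0 < orient p q (P i u))%R)).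
Proof.
by case=> -[hA hB]; [left | right]; split=> u hu; [apply: hA|apply: hB|apply: hA|apply: hB];
  exists u; rewrite // /posA /posB n12.
Qed.

Lemma chain_signs_chain : chain_signs m (chain o ch).
Proof.
have b_lt : (3 * m).-1 < 4 * m by lia.
have := tc_AB_convex hS; have := tc_C_convex hS; have := tc_AB_next hS.
have := tc_AB_C hS; have := tc_AB_remaining hS; have := tc_CC_other hS.
rewrite /posAB /posA /posB /posC /in_chain !n12 => h1 h2 h3 h4 h5 h6.
apply: chain_signsP => //.
- exact: chain3.
- by move=> i; apply: chain_gt0.
- exact: in_triangle_chain.
- by move=> i s t u stu uAB; apply: h6; lia.
- by move=> i s t u sC stu uC; apply: h5; lia.
- by move=> i s t u st tAB uP; apply: h4; lia.
- by move=> i s t u st tAB uC; apply: h3; lia.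
- by move=> i s t u st tAB uP; apply: h2; lia.
- move=> i s t sC st tC; apply: separates_AB.
  by apply: (tc_CC_separate hS); rewrite // /posC n12; lia.
- move=> i s t sC tC; apply: separates_AB.
  by apply: (tc_CC'_separate hS); rewrite // /posC n12; lia.
- by move=> i s t u sC st tC uC; apply: (h1 i s t u _ _ _ _).1; lia.
- by move=> i s t u sC st tC uC; apply: (h1 i s t u _ _ _ _).2; lia.
Qed.

Lemma num_le_edges_chain a : a < m ->
  num_le_edges S (4 * m + a) = 3 * 'C(4 * m + a + 2, 2) + 3 * 'C(a + 2, 2).
Proof.
move=> am; rewrite (num_le_edgesE _ perm_points).
rewrite -(num_le_sum m_gt0 chain3 chain_signs_chain am).
rewrite /chain_points big_allpairs_dep big_iota; apply: eq_bigr => i _.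
rewrite [RHS]exchange_big big_iota; apply: eq_bigr => s _.
rewrite big_allpairs_dep big_iota; apply: eq_bigr => j _.
rewrite big_iota; apply: eq_bigr => t _.
rewrite big_allpairs_dep big_iota !big_ord_recl big_ord0 addn0 addnA.
by rewrite !big_iota.
Qed.

End Main.

(** At [j = 4 * m + a + 1] the summand [3 * j - n + 3] is [3 * (a + 2)], three times the increment
    of the binomial. *)
Lemma lower_boundE m a :
  Posz (3 * 'C(4 * m + a + 2, 2) + 3 * 'C(a + 2, 2))
  = le_edges_lower_bound (12 * m) (4 * m + a).
Proof.
rewrite /le_edges_lower_bound PoszD (_ : 12 * m %/ 3 = 4 * m); last lia.
congr (_ + _)%R; elim: a => [|a IH].
  by rewrite addn0 big_nat1 (_ : 'C(0 + 2, 2) = 1) //; lia.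
rewrite (addnS (4 * m)) big_nat_recr /=; last lia.
by rewrite -IH addSn binS bin1; lia.
Qed.

Theorem theorem10 (R : realType) (n : nat) (S : {fset (R * R)%type})
    (hS : three_chain_configuration n S) (k : nat)
    (hk : (n %/ 3 <= k <= (5 * n) %/ 12 - 1)%N) :
  num_le_edges S k = (3 * 'C(k + 2, 2) + 3 * 'C(k - n %/ 3 + 2, 2))%N /\
  Posz (3 * 'C(k + 2, 2) + 3 * 'C(k - n %/ 3 + 2, 2))%N
    = le_edges_lower_bound n k.
Proof.
have [n_gt0 n12 [o [ch spec]]] := hS.
have [m nE] : exists m, n = 12 * m by exists (n %/ 12); lia.
subst n.
have m_gt0 : 0 < m by lia.
have -> : 12 * m %/ 3 = 4 * m by lia.
have [a kE] : exists a, k = 4 * m + a by exists (k - 4 * m); lia.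
subst k; rewrite addKn; split; last exact: lower_boundE.
(* The upper bound on [k] is [5 * m - 1], which gives [a < m]. *)
by apply: (num_le_edges_chain m_gt0 spec); lia.
Qed.
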